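(* Let $0\le\alpha<n$ and let $\mu$ be a locally finite Borel measure on $\mathbb{R}^n$. Then there is a constant $C>0$ depending only on $n$ and $\alpha$ such that for every $f\in L^1_{\mathrm{loc}}(\mathbb{R}^n)$, $$\|\mathrm{M}_\alpha f\|_{L^1(\mu)}\le C\,\|\mathrm{M}f\|_{L^1(\mathrm{M}_\alpha\mu)}.$$
   Context: A locally finite Borel measure on $\mathbb{R}^n$ is a positive Borel measure $\mu$ with $\mu(K)<\infty$ for every compact $K$. $\mathcal{L}$ denotes Lebesgue measure. For $0\le\alpha<n$, $\mathrm{M}_\alpha\mu(x)=\sup_{r>0} r^\alpha\,\mu(B_r(x))/\mathcal{L}(B_r(x))\in[0,\infty]$. For $f\in L^1_{\mathrm{loc}}(\mathbb{R}^n)$, $\mathrm{M}_\alpha f$ denotes $\mathrm{M}_\alpha$ of the measure $|f|\,dx$, and $\mathrm{M}=\mathrm{M}_0$ is the Hardy–Littlewood maximal operator. $\|g\|_{L^1(w)}=\int|g|\,w\,dx$ for a weight $w$ (with $0\cdot\infty=0$). *)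

(* Defs.v *)
From HB Require Import structures.
From mathcomp Require Import all_boot all_order all_algebra.
From mathcomp Require Import all_classical all_reals all_analysis.
From mathcomp Require Import measurable_realfun.

Set Implicit Arguments.
Unset Strict Implicit.
Unset Printing Implicit Defensive.

Import Order.TTheory GRing.Theory Num.Theory.
Import numFieldNormedType.Exports.

Local Open Scope classical_set_scope.
Local Open Scope ring_scope.

Definition borel_mx_display : measure_display.
Proof. exact: default_measure_display. Qed.

Section borel_mx.
Variables (R : realType) (m n : nat).

Let borel : set (set 'M[R]_(m, n)) := <<s open >>.

Let borel_set0 : borel set0.
Proof. exact: sigma_algebra0. Qed.

Let borel_setC A : borel A -> borel (~` A).
Proof. exact: (@sigma_algebraC 'M[R]_(m, n)). Qed.

Let borel_bigcup (F : (set 'M[R]_(m, n))^nat) :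
  (forall i, borel (F i)) -> borel (\bigcup_i F i).
Proof. exact: sigma_algebra_bigcup. Qed.

HB.instance Definition _ := @isMeasurable.Build borel_mx_display
  'M[R]_(m, n) borel borel_set0 borel_setC borel_bigcup.

End borel_mx.

Section borel_rV.
Variables (R : realType) (n : nat).

Lemma open_rV_measurable (A : set 'rV[R]_n) : open A -> measurable A.
Proof. exact: sub_sigma_algebra. Qed.

Lemma measurable_coord_rV (i : 'I_n) :
  measurable_fun [set: 'rV[R]_n] (fun y => y ord0 i).
Proof.
apply: (measurability _ (RGenOpens.measurableE R)) => _ [_ [a [b ->]] <-].
rewrite setTI; apply: open_rV_measurable.
by apply: open_comp => [x _|]; [exact: coord_continuous|exact: interval_open].
Qed.

(* the rational balls form a countable basis of the topology *)
Lemma open_rV_bigcup_ball (U : set 'rV[R]_n) : open U ->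
  U = \bigcup_(q : 'rV[rat]_n * nat) [set y |
    ball (map_mx ratr q.1 : 'rV[R]_n) q.2.+1%:R^-1 y /\
    ball (map_mx ratr q.1 : 'rV[R]_n) q.2.+1%:R^-1 `<=` U].
Proof.
move=> oU; apply/seteqP; split=> [x Ux|x [q _ [? /(_ x)]]]; last exact.
have /nbhs_ballP[e /= e0 xeU] : nbhs x U by exact: open_nbhs_nbhs.
have [k ke] : exists k, k.+1%:R^-1 < e / 2 :> R.
  have e2 : 0 < e / 2 by rewrite divr_gt0.
  exists (Num.truncn (e / 2)^-1).
  by rewrite invf_plt ?posrE// truncnS_gt.
have qP i : {q : rat | `|ratr q - x ord0 i| < k.+1%:R^-1}.
  apply: cid; have k0 : 0 < k.+1%:R^-1 :> R by rewrite invr_gt0.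
  have /rat_in_itvoo[q] : x ord0 i - k.+1%:R^-1 < x ord0 i + k.+1%:R^-1.
    by rewrite ltrD2l gtrN.
  by rewrite in_itv/= => qx; exists q; rewrite ltr_distl.
have xq : ball (map_mx ratr (\row_i sval (qP i)) : 'rV[R]_n) k.+1%:R^-1 x.
  split=> [|i j]; first by rewrite invr_gt0.
  by rewrite !mxE (ord1 i); exact: (svalP (qP j)).
exists (\row_i sval (qP i), k) => //=; split=> // y qy; apply: xeU.
have : ball x (k.+1%:R^-1 + k.+1%:R^-1) y.
  exact: ball_triangle (ball_sym xq) qy.
by apply: le_ball; rewrite [leRHS]splitr; apply: lerD; exact: ltW.
Qed.

End borel_rV.

Section cons_rV.
Variables (R : realType) (n : nat).

Definition cons_rV (p : measurableTypeR R * 'rV[R]_n) : 'rV[R]_n.+1 :=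
  \row_i (if unlift ord0 i is Some j then p.2 ord0 j else p.1).

Definition uncons_rV (y : 'rV[R]_n.+1) : measurableTypeR R * 'rV[R]_n :=
  (y ord0 ord0, \row_i y ord0 (lift ord0 i)).

Lemma cons_rVK : cancel cons_rV uncons_rV.
Proof.
move=> [a v]; congr pair; first by rewrite mxE unlift_none.
by apply/rowP => i; rewrite !mxE liftK.
Qed.

Lemma measurable_cons_rV : measurable_fun setT cons_rV.
Proof.
apply: (measurability (@open 'rV[R]_n.+1)) => // _ [U oU <-]; rewrite setTI.
rewrite (open_rV_bigcup_ball oU) preimage_bigcup.
apply: countable_bigcupT_measurable => // -[q k] /=.
have [qU|qU] := pselect
  (ball (map_mx ratr q : 'rV[R]_n.+1) k.+1%:R^-1 `<=` U); last first.
  by rewrite (_ : _ @^-1` _ = set0)// -subset0 => p [].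
pose q' : 'rV[R]_n := \row_i ratr (q ord0 (lift ord0 i)).
rewrite (_ : _ @^-1` _ = ball (ratr (q ord0 ord0) : R) k.+1%:R^-1 `*`
    ball q' k.+1%:R^-1); last first.
  apply/seteqP; split=> [[a v] [[k0 qk] _]|[a v] [/= qa [k0 qk]]].
    split=> /=.
      by have := qk ord0 ord0; rewrite !mxE unlift_none.
    split=> // i j; have := qk ord0 (lift ord0 j).
    by rewrite !mxE liftK (ord1 i).
  split=> //; split=> // i j; rewrite !mxE (ord1 i).
  case: unliftP => [j' ->|->]//=.
  by have := qk ord0 j'; rewrite !mxE.
apply: measurableX; first by apply: measurable_ball.
by apply: open_rV_measurable; exact: ball_open.
Qed.

Lemma measurable_uncons_rV : measurable_fun setT uncons_rV.
Proof.
apply: measurable_fun_pair; first exact: (measurable_coord_rV ord0).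
apply: (measurability (@open 'rV[R]_n)) => // _ [U oU <-]; rewrite setTI.
apply: open_rV_measurable; apply: open_comp => // y _.
move=> V /nbhs_ballP[e /= e0 yV]; apply/nbhs_ballP; exists e => //= z [_ yz].
by apply: yV; split=> // i j; rewrite !mxE; exact: yz.
Qed.

Variable mu : {sigma_finite_measure set 'rV[R]_n -> \bar R}.

Definition cons_measure : set 'rV[R]_n.+1 -> \bar R :=
  pushforward (lebesgue_measure \x mu)%E cons_rV.

Let cons_measure_pf : {measure set 'rV[R]_n.+1 -> \bar R} :=
  measure_function_pushforward__canonical__measure_function_Measure
    (lebesgue_measure \x mu)%E measurable_cons_rV.

Let cons_measure0 : cons_measure set0 = 0%E.
Proof. exact: (measure0 cons_measure_pf). Qed.

Let cons_measure_ge0 A : (0 <= cons_measure A)%E.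
Proof. exact: (measure_ge0 cons_measure_pf). Qed.

Let cons_measure_sigma_additive : semi_sigma_additive cons_measure.
Proof. exact: (@measure_semi_sigma_additive _ _ _ cons_measure_pf). Qed.

HB.instance Definition _ := isMeasure.Build _ _ _ cons_measure
  cons_measure0 cons_measure_ge0 cons_measure_sigma_additive.

Let cons_measure_sigma_finite : sigma_finite setT cons_measure.
Proof.
have /sigma_finiteP[F [FT ndF Foo]] :=
  sigma_finiteT (@lebesgue_measure R : {sigma_finite_measure set _ -> \bar R}).
have /sigma_finiteP[G [GT ndG Goo]] := sigma_finiteT mu.
exists (fun k => uncons_rV @^-1` (F k `*` G k)).
  apply/seteqP; split=> // y _.
  have [k _ Fk] : (\bigcup_i F i) (uncons_rV y).1 by rewrite -FT.
  have [l _ Gl] : (\bigcup_i G i) (uncons_rV y).2 by rewrite -GT.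
  exists (maxn k l) => //; split.
    by move: Fk; exact/subsetPset/ndF/leq_maxl.
  by move: Gl; exact/subsetPset/ndG/leq_maxr.
move=> k; have [mF Fkoo] := Foo k; have [mG Gkoo] := Goo k; split.
  rewrite -[X in measurable X]setTI; apply: measurable_uncons_rV => //.
  exact: measurableX.
rewrite /cons_measure /pushforward (_ : _ @^-1` _ = F k `*` G k).
  by rewrite product_measure1E// lte_mul_pinfty// ge0_fin_numE.
by rewrite -comp_preimage (_ : uncons_rV \o cons_rV = id)//; exact/funext/cons_rVK.
Qed.

HB.instance Definition _ := Measure_isSigmaFinite.Build _ _ _ cons_measure
  cons_measure_sigma_finite.

End cons_rV.

Fixpoint lebesgue_rV (R : realType) (n : nat) :
    {sigma_finite_measure set 'rV[R]_n -> \bar R} :=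
  if n is m.+1 then cons_measure (lebesgue_rV R m) else \d_(0 : 'rV[R]_0).

Lemma lebesgue_rV_box (R : realType) (n : nat) (A : 'I_n -> set R) :
  (forall i, measurable (A i)) ->
  lebesgue_rV R n [set y | forall i, A i (y ord0 i)] =
  (\prod_(i < n) lebesgue_measure (A i))%E.
Proof.
elim: n A => [|n IHn] A mA.
  rewrite [X in lebesgue_rV R 0 X](_ : _ = setT); last first.
    by apply/seteqP; split=> // y _ [].
  by rewrite big_ord0 /= diracT.
rewrite big_ord_recl -IHn//= /cons_measure /pushforward.
rewrite -product_measure1E; [|exact: mA|]; last first.
  rewrite [X in measurable X](_ : _ = \bigcap_(i in [set: 'I_n])
      ((fun y : 'rV[R]_n => y ord0 i) @^-1` A (lift ord0 i))); last first.
    by apply/seteqP; split=> y Ay i //=; exact: Ay.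
  apply: fin_bigcap_measurable => // i _.
  rewrite -[X in measurable X]setTI; exact: measurable_coord_rV.
congr (_ _); apply/seteqP; split=> [[a v] /= Aav|[a v] /= [Aa Av] i].
  split=> [|i]; first by have := Aav ord0; rewrite mxE unlift_none.
  by have := Aav (lift ord0 i); rewrite mxE liftK.
by rewrite mxE; case: unliftP => [j ->|->].
Qed.

Section maximal_operators.
Context {R : realType} {n : nat}.
Implicit Types (x : 'rV[R]_n) (f : 'rV[R]_n -> R).
Local Open Scope ereal_scope.

Local Notation leb := (lebesgue_rV R n).

(* the library's ball on 'rV[R]_n is that of the sup norm *)
Definition eball x (r : R) : set 'rV[R]_n :=
  [set y | (Num.sqrt (\sum_(i < n) (y ord0 i - x ord0 i) ^+ 2) < r)%R].

Definition locally_finite (mu : set 'rV[R]_n -> \bar R) :=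
  forall K : set 'rV[R]_n, compact K -> mu K < +oo.

(* [measurable] is Borel; up to a null set, this is Lebesgue measurability *)
Definition lebesgue_measurable_fun f :=
  exists2 g : 'rV[R]_n -> R, measurable_fun setT g & {ae leb, forall x, f x = g x}.

Definition L1loc f := lebesgue_measurable_fun f /\
  forall K : set 'rV[R]_n, compact K -> \int[leb]_(x in K) `|f x|%:E < +oo.

Definition frac_maximal (alpha : R) (mu : set 'rV[R]_n -> \bar R) x : \bar R :=
  ereal_sup [set (r `^ alpha)%:E * (mu (eball x r) / leb (eball x r)) |
             r in `]0%R, +oo[%classic].

Definition frac_maximal_fun (alpha : R) f : 'rV[R]_n -> \bar R :=
  frac_maximal alpha (fun A => \int[leb]_(y in A) `|f y|%:E).

Definition HL_maximal_fun f : 'rV[R]_n -> \bar R := frac_maximal_fun 0%R f.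

Definition L1norm (mu : set 'rV[R]_n -> \bar R) (g : 'rV[R]_n -> \bar R) :=
  \int[mu]_x `|g x|.

Definition weighted_L1norm (w g : 'rV[R]_n -> \bar R) :=
  \int[leb]_x (`|g x| * w x).

End maximal_operators.

(* Main.v *)
Require Import Defs.
From mathcomp Require Import all_boot all_order all_algebra.
From mathcomp Require Import all_classical all_reals all_analysis.
From mathcomp Require Import measurable_realfun zify lra ring.

Import Order.TTheory GRing.Theory Num.Theory.
Import numFieldNormedType.Exports.

Local Open Scope classical_set_scope.
Local Open Scope ring_scope.

(** On dyadic cubes Q of side l = 2^(N-j), 0 <= j <= 2N, put
    g_j = l^-n nu(3Q), where nu = |f| dx, and a_j = l^alpha g_j.  Up to
    constants, M_alpha f is the supremum over N of A = max_j a_j, while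
    g_j <= C Mf and l^alpha mu(Q) / l^n <= C M_alpha mu.  The increments d_j of
    the running maxima of the a_j, from coarse to fine scales, are constant on
    the cubes of scale j, so int A dmu = int sum_j d_j mu(Q_j) / l_j^n dx,
    which is at most C int (sum_j d_j l_j^-alpha) M_alpha mu dx.  As l_j^-alpha
    grows with j, the inner sum is at most a_j l_j^-alpha = g_j for the last j
    with d_j != 0, hence at most C Mf. *)

(** The integral of a nonnegative function is the supremum of the integrals of the simple functions
    below it, so monotonicity holds for arbitrary functions, maximal functions in particular. *)
Lemma ge0_le_integralT d (T : measurableType d) (R : realType)
    (mu : {measure set T -> \bar R}) (f g : T -> \bar R) :
  (forall x, 0 <= f x)%E -> (forall x, f x <= g x)%E ->
  (\int[mu]_x f x <= \int[mu]_x g x)%E.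
Proof.
move=> f0 fg; have g0 x : (0 <= g x)%E by exact: le_trans (fg x).
rewrite !ge0_integralTE//; apply: ereal_sup_le => _ [h /= hf <-].
by exists h => //= x; exact: le_trans (fg x).
Qed.

(** * Boxes and Euclidean balls: inclusions and volumes *)

Section boxes_and_balls.
Context {R : realType} {n : nat}.
Implicit Types (x y : 'rV[R]_n) (r s l : R).

Local Notation leb := (lebesgue_rV R n).

Lemma measurable_box_rV (A : 'I_n -> set R) : (forall i, measurable (A i)) ->
  measurable [set y : 'rV[R]_n | forall i, A i (y ord0 i)].
Proof.
move=> mA; rewrite [X in measurable X](_ : _ = \bigcap_(i in [set: 'I_n])
    ((fun y : 'rV[R]_n => y ord0 i) @^-1` A i)); last first.
  by apply/seteqP; split=> y Ay i //=; exact: Ay.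
apply: fin_bigcap_measurable => // i _; rewrite -[X in measurable X]setTI.
exact: measurable_coord_rV.
Qed.

Lemma lebesgue_rV_itv (a : 'I_n -> R) s b c : 0 < s ->
  leb [set y | forall i, [set` Interval (BSide b (a i)) (BSide c (a i + s))]
                           (y ord0 i)] = (s ^+ n)%:E.
Proof.
move=> s0; rewrite (lebesgue_rV_box (A := fun i =>
  [set` Interval (BSide b (a i)) (BSide c (a i + s))]))//.
rewrite (eq_bigr (fun=> s%:E)) => [|i _].
  by rewrite prodEFin prodr_const card_ord.
by rewrite lebesgue_measure_itv/= lte_fin ltrDl s0 -EFinB addrAC subrr add0r.
Qed.

Lemma measurable_eball x r : measurable (eball x r).
Proof.
rewrite -[X in measurable X]setTI /eball.
have m : measurable_fun setT (fun y : 'rV[R]_n =>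
    Num.sqrt (\sum_(i < n) (y ord0 i - x ord0 i) ^+ 2)).
  apply: (measurableT_comp (f := @Num.sqrt R)).
    by apply: continuous_measurable_fun; exact: sqrt_continuous.
  apply: measurable_sum => i; apply: measurable_funX.
  by apply: measurable_funB => //; exact: measurable_coord_rV.
rewrite [X in _ `&` X](_ : _ = (fun y : 'rV[R]_n =>
    Num.sqrt (\sum_(i < n) (y ord0 i - x ord0 i) ^+ 2)) @^-1` `]-oo, r[).
  exact: m.
by apply/seteqP; split => y /=; rewrite in_itv.
Qed.

Lemma eball_coord {x r y} i : eball x r y -> `|y ord0 i - x ord0 i| < r.
Proof.
apply: le_lt_trans; rewrite -sqrtr_sqr; apply: ler_wsqrtr.
by rewrite (bigD1 i)//= lerDl sumr_ge0// => j _; exact: sqr_ge0.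
Qed.

(** The sum of squares is at most n (r/(2n))^2 = r^2/(4n), and the factor 2 keeps this strictly
    below r^2 even for n = 1. *)
Lemma eball_of_coord {x r y} : (0 < n)%N -> 0 < r ->
  (forall i, `|y ord0 i - x ord0 i| <= r / (2 * n%:R)) -> eball x r y.
Proof.
move=> n0 r0 xy; have nR : 1 <= n%:R :> R by rewrite ler1n.
rewrite /eball/= -[ltRHS](gtr0_norm r0) -sqrtr_sqr ltr_sqrt ?exprn_gt0//.
apply: (@le_lt_trans _ _ (\sum_(i < n) (r / (2 * n%:R)) ^+ 2)).
  apply: ler_sum => i _; rewrite -[leLHS]real_normK ?num_real//.
  by rewrite ler_pXn2r// nnegrE divr_ge0// ?mulr_ge0// ltW.
rewrite sumr_const card_ord -[ltLHS]mulr_natr.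
have -> : (r / (2 * n%:R)) ^+ 2 * n%:R = r ^+ 2 * (4 * n%:R)^-1.
  by field; rewrite gt_eqF//; lra.
rewrite gtr_pMr ?exprn_gt0// invf_lt1; lra.
Qed.

Lemma lebesgue_eball_le x r : 0 < r ->
  (leb (eball x r) <= ((2 * r) ^+ n)%:E)%E.
Proof.
(* The ball lies in the half-open cube of centre x and side 2r. *)
move=> r0; rewrite -(@lebesgue_rV_itv (fun i => x ord0 i - r) _ true true);
  last by lra.
apply: le_measure; rewrite ?inE; [exact: measurable_eball| |].
  exact: (measurable_box_rV (fun i =>
    [set` Interval (BLeft (x ord0 i - r)) (BLeft (x ord0 i - r + 2 * r))])).
move=> y xy i; have := eball_coord i xy.
by rewrite /= in_itv/= ltr_norml => /andP[? ?]; apply/andP; split; lra.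
Qed.

Lemma lebesgue_eball_ge x r : (0 < n)%N -> 0 < r ->
  (((r / n%:R) ^+ n)%:E <= leb (eball x r))%E.
Proof.
move=> n0 r0; have nR : 0 < n%:R :> R by rewrite ltr0n.
(* The ball contains the closed cube of centre x and side r/n. *)
rewrite -(@lebesgue_rV_itv (fun i => x ord0 i - r / (2 * n%:R)) _ true false);
  last by rewrite divr_gt0.
apply: le_measure; rewrite ?inE; [|exact: measurable_eball|].
  exact: (measurable_box_rV (fun i =>
    [set` Interval (BLeft (x ord0 i - r / (2 * n%:R)))
                   (BRight (x ord0 i - r / (2 * n%:R) + r / n%:R))])).
move=> y xy; apply: eball_of_coord => // i; have := xy i.
have -> : r / n%:R = 2 * (r / (2 * n%:R)) by field; rewrite gt_eqF.
by rewrite /= in_itv/= ler_norml => /andP[? ?]; apply/andP; split; lra.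
Qed.

End boxes_and_balls.

(** * The grid of half-open cubes of side l, and its nesting under doubling *)

Section cubes.
Context {R : realType} {n : nat} (l : R) (l_gt0 : 0 < l).
Implicit Types (x y : 'rV[R]_n) (q : 'rV[int]_n).

Local Notation leb := (lebesgue_rV R n).

Definition cube_index x : 'rV[int]_n := \row_i Num.floor (x ord0 i / l).

Definition cube q : set 'rV[R]_n := [set y | cube_index y = q].

(** The concentric cube 3Q. Taken closed, it is compact, so locally finite set functions are finite
    on it. *)
Definition cube3 q : set 'rV[R]_n := [set y | forall i,
  y ord0 i \in `[((q ord0 i)%:~R - 1) * l, ((q ord0 i)%:~R - 1) * l + 3 * l]].

Definition corner q : 'rV[R]_n := \row_i ((q ord0 i)%:~R * l).

Lemma cornerK : cancel corner cube_index.
Proof.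
by move=> q; apply/rowP => i; rewrite !mxE mulfK ?gt_eqF// intrKfloor.
Qed.

Lemma cubeE q : cube q = [set y | forall i,
  y ord0 i \in `[(q ord0 i)%:~R * l, (q ord0 i)%:~R * l + l[].
Proof.
have lD (a : R) : a * l + l = (a + 1) * l by ring.
apply/seteqP; split=> y /= qy.
  move=> i; rewrite -qy mxE /= in_itv/= -ler_pdivlMr//.
  rewrite lD -ltr_pdivrMr//.
  by have := floor_itv (y ord0 i / l); rewrite intrD.
apply/rowP => i; rewrite mxE; apply/floor_def.
have := qy i; rewrite in_itv/= -ler_pdivlMr//.
by rewrite lD -ltr_pdivrMr// intrD.
Qed.

Lemma measurable_cube q : measurable (cube q).
Proof.
rewrite cubeE; apply: (measurable_box_rV (fun i =>
  [set` `[(q ord0 i)%:~R * l, (q ord0 i)%:~R * l + l[])) => i.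
exact: measurable_itv.
Qed.

Lemma lebesgue_cube q : leb (cube q) = (l ^+ n)%:E.
Proof. by rewrite cubeE lebesgue_rV_itv. Qed.

Lemma compact_cube3 q : compact (cube3 q).
Proof.
have /(_ (fun i => @segment_compact _ _ _)) := @rV_compact R n (fun i =>
  `[((q ord0 i)%:~R - 1) * l, ((q ord0 i)%:~R - 1) * l + 3 * l]%classic).
exact.
Qed.

Lemma cube3_dist {x y} i : cube3 (cube_index x) y ->
  `|y ord0 i - x ord0 i| <= 2 * l.
Proof.
move=> /(_ i); have : cube (cube_index x) x by [].
rewrite cubeE => /(_ i); rewrite /= !in_itv/= ler_norml mulrBl mul1r.
by move=> /andP[? ?] /andP[? ?]; apply/andP; split; lra.
Qed.

Lemma dist_cube3 x y : (forall i, `|y ord0 i - x ord0 i| <= l) ->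
  cube3 (cube_index x) y.
Proof.
move=> xy i; have : cube (cube_index x) x by [].
rewrite cubeE => /(_ i); rewrite /= !in_itv/= mulrBl mul1r.
have := xy i; rewrite ler_norml.
by move=> /andP[? ?] /andP[? ?]; apply/andP; split; lra.
Qed.

Definition cube_constant {T : Type} (h : 'rV[R]_n -> T) :=
  forall x y, cube_index x = cube_index y -> h x = h y.

Lemma cube_constant_corner {T : Type} (h : 'rV[R]_n -> T) x :
  cube_constant h -> h x = h (corner (cube_index x)).
Proof. by apply; rewrite cornerK. Qed.

(** Every preimage is a union of grid cubes, of which there are countably many. *)
Lemma measurable_cube_constant (h : 'rV[R]_n -> \bar R) :
  cube_constant h -> measurable_fun setT h.
Proof.
move=> hc _ Y mY; rewrite setTI.
rewrite (_ : _ @^-1` _ = \bigcup_q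
    (if `[< Y (h (corner q)) >] then cube q else set0)); last first.
  apply/seteqP; split=> [x Yx|x [q _]].
    exists (cube_index x) => //; case: asboolP => // -[].
    by rewrite -cube_constant_corner.
  by case: asboolP => // Yq xq; rewrite /= (cube_constant_corner _ _ hc) xq.
apply: countable_bigcupT_measurable => // q.
by case: ifP => // _; exact: measurable_cube.
Qed.

(** This trades [mu] for Lebesgue measure: on a cube Q, integrating the constant mu(Q)/l^n over
    volume l^n gives back mu(Q). *)
Lemma integral_cube_constant (mu : {measure set 'rV[R]_n -> \bar R})
    (h : 'rV[R]_n -> \bar R) :
  cube_constant h -> (forall x, 0 <= h x)%E ->
  (\int[mu]_x h x =
   \int[leb]_x (h x * (mu (cube (cube_index x)) * ((l ^+ n)^-1)%:E)))%E.
Proof.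
move=> hc h0; have ln0 : 0 < l ^+ n by rewrite exprn_gt0.
(* The cubes are enumerated by the codes of their indices; a number that codes no index gets the
   empty set. *)
pose F k := if pickle_inv k is Some q then cube q else set0.
have FT : [set: 'rV[R]_n] = \bigcup_k F k.
  apply/seteqP; split=> // x _; exists (pickle (cube_index x)) => //.
  by rewrite /F pickleK_inv.
have mF k : measurable (F k).
  by rewrite /F; case: pickle_inv => // q; exact: measurable_cube.
have tF : trivIset setT F.
  apply/trivIsetP => i j _ _ /eqP ij; apply/seteqP; split=> // x [].
  rewrite /F; case Ei: pickle_inv => [q|//]; case Ej: pickle_inv => [q'|//].
  move=> xq xq'; apply: ij; have qq' : q = q' := etrans (esym xq) xq'.
  have := @pickle_invK 'rV[int]_n i; have := @pickle_invK 'rV[int]_n j.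
  by rewrite Ei Ej /= qq' => <- <-.
pose w x := (mu (cube (cube_index x)) * ((l ^+ n)^-1)%:E)%E.
have w0 x : (0 <= w x)%E by rewrite mule_ge0// lee_fin invr_ge0 ltW.
have hwc : cube_constant (fun x => h x * w x)%E.
  by move=> x y xy; rewrite (hc x y)// /w xy.
rewrite [in LHS]FT [in RHS]FT !ge0_integral_bigcup//; do ?by [
  rewrite -FT; exact: measurable_cube_constant |
  move=> x _; exact: (mule_ge0 (h0 x) (w0 x))].
apply: eq_eseriesr => k _; have := mF k; rewrite /F.
case: pickle_inv => [q|_]; last by rewrite !integral_set0.
move=> mq.
rewrite (@eq_integral _ _ _ _ (cube q) (cst (h (corner q)))); last first.
  by move=> x /[!inE] qx; rewrite -qx; exact: (cube_constant_corner _ _ hc).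
rewrite [RHS](@eq_integral _ _ _ _ (cube q)
    (cst (h (corner q) * w (corner q))%E)); last first.
  by move=> x /[!inE] qx; rewrite -qx; exact: (cube_constant_corner _ _ hwc).
rewrite !integral_cst// [X in _ = (_ * X)%E](lebesgue_cube q).
by rewrite /w cornerK -!muleA -EFinM mulVf ?gt_eqF// mule1.
Qed.

End cubes.

(** The floor of t/2 depends only on the floor of t: k <= t/2 < k+1 bounds t by the integers 2k and
    2(k+1), and integer bounds of this kind pass to the floor. *)
Lemma cube_index_double {R : realType} {n : nat} (l : R) (x y : 'rV[R]_n) :
  0 < l -> cube_index l x = cube_index l y ->
  cube_index (2 * l) x = cube_index (2 * l) y.
Proof.
move=> l0 /rowP xy; apply/rowP => i; have := xy i; rewrite !mxE => {}xy.
apply/esym/floor_def.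
have -> : y ord0 i / (2 * l) = (y ord0 i / l) / 2 by field; rewrite gt_eqF.
have -> : x ord0 i / (2 * l) = (x ord0 i / l) / 2 by field; rewrite gt_eqF.
set s := x ord0 i / l in xy *; set t := y ord0 i / l in xy *.
rewrite ler_pdivlMr// ltr_pdivrMr// -!(intrM _ _ 2).
rewrite -floor_ge_int -floor_lt_int -xy floor_ge_int floor_lt_int.
rewrite !intrM -ler_pdivlMr// -ltr_pdivrMr//; exact: floor_itv.
Qed.

(** * Running maxima of real sequences and weighted sums of their increments *)

Section running_max.
Context {R : realType}.
Implicit Types (a p : nat -> R) (c : R).

(** Starting from 0 makes every increment nonnegative and lets the increments sum exactly to the
    maximum; the index m itself is excluded. *)
Fixpoint running_max a m : R :=
  if m is k.+1 then Num.max (running_max a k) (a k) else 0.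

Lemma running_max_ge0 a m : 0 <= running_max a m.
Proof. by elim: m => //= m IH; rewrite le_max IH. Qed.

Lemma running_maxS a m : running_max a m <= running_max a m.+1.
Proof. by rewrite /= le_max lexx. Qed.

Lemma ler_running_max a m j : (j < m)%N -> a j <= running_max a m.
Proof.
elim: m => //= m IH; rewrite ltnS leq_eqVlt le_max => /predU1P[->|/IH->//].
by rewrite lexx orbT.
Qed.

Lemma running_max_le a m c : 0 <= c -> (forall j, (j < m)%N -> a j <= c) ->
  running_max a m <= c.
Proof.
move=> c0; elim: m => //= m IH ac; rewrite ge_max ac// andbT.
by apply: IH => j jm; apply: ac; exact: ltnW.
Qed.

(* If [j] is the last index with a nonzero increment, then the running maximum
   is [a j] there, and bounding all weights by [p j] makes the sum telescope to
   at most [p j * a j]. *)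
Lemma running_max_weighted a p c m : (forall j, 0 <= p j) ->
  {homo p : i j / (i <= j)%N >-> i <= j} -> 0 <= c ->
  (forall j, (j < m)%N -> p j * a j <= c) ->
  \sum_(j < m) (running_max a j.+1 - running_max a j) * p j <= c.
Proof.
move=> p0 pnd c0 pac.
(* The second bound strengthens the induction: it controls the earlier terms when [a m] becomes the
   new maximum. *)
suff : \sum_(j < m) (running_max a j.+1 - running_max a j) * p j <= c /\
       \sum_(j < m) (running_max a j.+1 - running_max a j) * p j <=
         running_max a m * p m by case.
elim: m pac => [|m IH] pac; first by rewrite !big_ord0 mul0r.
have [j jm|Sc Sp] := IH; first by apply: pac; exact: ltnW.
pose S k := \sum_(j < k) (running_max a j.+1 - running_max a j) * p j.
have SE : S m.+1 = S m + (running_max a m.+1 - running_max a m) * p m.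
  by rewrite /S big_ord_recr.
rewrite -/(S m.+1) -/(S m) in Sc Sp *; rewrite SE.
have Sm : S m + (running_max a m.+1 - running_max a m) * p m <=
    running_max a m.+1 * p m.
  by rewrite mulrBl; lra.
split; last first.
  by apply: (le_trans Sm); rewrite ler_wpM2l// ?running_max_ge0// pnd.
have [am|] := boolP (a m <= running_max a m).
  by rewrite /= (max_idPl am) subrr mul0r addr0.
rewrite -ltNge => /ltW am.
by apply: (le_trans Sm); rewrite /= (max_idPr am) mulrC; exact: pac.
Qed.

End running_max.

(** * Averages over balls against averages over cubes *)

Section dyadic_comparison.
Context {R : realType} {n : nat} (n_gt0 : (0 < n)%N).
Implicit Types (x : 'rV[R]_n) (l r alpha : R) (nu : set 'rV[R]_n -> \bar R).

Lemma frac_maximal_ge alpha nu x r : 0 < r ->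
  ((r `^ alpha)%:E * (nu (eball x r) / lebesgue_rV R n (eball x r)) <=
   frac_maximal alpha nu x)%E.
Proof.
by move=> r0; apply: ereal_sup_ubound; exists r => //=; rewrite in_itv/= r0.
Qed.

Lemma frac_maximal_ge0 alpha nu x : (forall A, 0 <= nu A)%E ->
  (0 <= frac_maximal alpha nu x)%E.
Proof.
move=> nu0; apply: le_trans (@frac_maximal_ge alpha nu x 1 _) => //.
by rewrite mule_ge0 ?lee_fin ?powR_ge0// mule_ge0// inve_ge0.
Qed.

(** The radius r = 4nl satisfies r/(2n) = 2l, so the ball contains both Q and 3Q for the cube Q
    around x. Its volume is at most (2r)^n = (8n)^n l^n, whence the constant, and l^alpha <=
    r^alpha. *)
Lemma average_le_frac_maximal alpha nu x l (E : set 'rV[R]_n) :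
  0 <= alpha -> 0 < l -> (0 <= nu E)%E ->
  (nu E <= nu (eball x (4 * n%:R * l)))%E ->
  ((l `^ alpha)%:E * (nu E * ((l ^+ n)^-1)%:E) <=
   ((8 * n%:R) ^+ n)%:E * frac_maximal alpha nu x)%E.
Proof.
move=> alpha0 l0 E0 EB.
have nR : 1 <= n%:R :> R by rewrite ler1n.
set r := 4 * n%:R * l.
have r0 : 0 < r by rewrite /r !mulr_gt0//; lra.
have lr : l <= r by rewrite /r ler_peMl// ?ltW//; lra.
have K0 : 0 < (8 * n%:R) ^+ n :> R by rewrite exprn_gt0//; lra.
apply: (@le_trans _ _ (((8 * n%:R) ^+ n)%:E *
    ((r `^ alpha)%:E * (nu (eball x r) / lebesgue_rV R n (eball x r))))%E);
  last first.
  by apply: lee_wpmul2l; [rewrite lee_fin ltW|exact: frac_maximal_ge].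
rewrite [leRHS]muleCA; apply: lee_pmul => //.
- by rewrite lee_fin powR_ge0.
- by rewrite mule_ge0// lee_fin invr_ge0 exprn_ge0// ltW.
- by rewrite lee_fin ge0_ler_powR// nnegrE ltW.
rewrite [leRHS]muleCA; apply: lee_pmul => //.
  by rewrite lee_fin invr_ge0 exprn_ge0// ltW.
have -> : (l ^+ n)^-1 = (8 * n%:R) ^+ n * ((2 * r) ^+ n)^-1.
  rewrite -!exprVn -exprMn; congr (_ ^+ n); rewrite /r; field.
  by rewrite !gt_eqF//; lra.
rewrite EFinM; apply: lee_wpmul2l; first by rewrite lee_fin ltW.
have r2 : (2 * r) ^+ n != 0 by rewrite expf_neq0// gt_eqF// mulr_gt0.
have -> : (((2 * r) ^+ n)^-1)%:E = (((2 * r) ^+ n)%:E)^-1%E.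
  by rewrite inver (negbTE r2).
rewrite lee_pV2 ?inE ?measure_ge0//; first exact: lebesgue_eball_le.
by rewrite lee_fin exprn_ge0// mulr_ge0// ltW.
Qed.

Lemma cube3_sub_eball x l : 0 < l ->
  cube3 l (cube_index l x) `<=` eball x (4 * n%:R * l).
Proof.
move=> l0 y xy; have nR : 0 < n%:R :> R by rewrite ltr0n.
apply: eball_of_coord => // [|i]; first by rewrite !mulr_gt0.
have -> : 4 * n%:R * l / (2 * n%:R) = 2 * l by field; rewrite gt_eqF.
exact: cube3_dist.
Qed.

Lemma cube_sub_eball x l : 0 < l ->
  cube l (cube_index l x) `<=` eball x (4 * n%:R * l).
Proof.
move=> l0 y xy; apply: cube3_sub_eball => //.
by rewrite -[cube_index l x]xy; apply: dist_cube3 => // i;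
  rewrite subrr normr0 ltW.
Qed.

(** As r <= l, the ball lies in 3Q and r^alpha <= l^alpha; as l <= 2r, its volume is at least
    (r/n)^n >= (l/(2n))^n. *)
Lemma ball_average_le_cube3 alpha nu x l r : 0 <= alpha -> 0 < r ->
  r <= l -> l <= 2 * r -> (forall A, 0 <= nu A)%E ->
  (forall A B, A `<=` B -> nu A <= nu B)%E ->
  ((r `^ alpha)%:E * (nu (eball x r) / lebesgue_rV R n (eball x r)) <=
   ((2 * n%:R) ^+ n)%:E *
   ((l `^ alpha)%:E * (nu (cube3 l (cube_index l x)) * ((l ^+ n)^-1)%:E)))%E.
Proof.
move=> alpha0 r0 rl lr nu0 nuS; have nR : 0 < n%:R :> R by rewrite ltr0n.
have l0 : 0 < l by exact: lt_le_trans rl.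
rewrite [leRHS]muleCA; apply: lee_pmul => //.
- by rewrite lee_fin powR_ge0.
- by rewrite mule_ge0// inve_ge0.
- by rewrite lee_fin ge0_ler_powR// nnegrE ltW.
rewrite [leRHS]muleCA; apply: lee_pmul => //.
- by rewrite inve_ge0.
- apply: nuS => y xy; apply: dist_cube3 => // i; apply: le_trans rl.
  by apply: ltW; exact: eball_coord.
have rn : (r / n%:R) ^+ n != 0 by rewrite expf_neq0// gt_eqF// divr_gt0.
apply: (@le_trans _ _ (((r / n%:R) ^+ n)%:E^-1)%E).
  rewrite lee_pV2 ?inE ?measure_ge0//; first exact: lebesgue_eball_ge.
  by rewrite lee_fin exprn_ge0// divr_ge0// ltW.
rewrite inver (negbTE rn) -EFinM lee_fin -!exprVn -exprMn.
apply: lerXn2r; rewrite ?nnegrE.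
- by rewrite invr_ge0 divr_ge0// ltW.
- by rewrite mulr_ge0 ?mulr_ge0 ?invr_ge0// ltW.
rewrite invf_div ler_pdivrMr// mulrAC ler_pdivlMr//.
by rewrite [2 * _]mulrC -mulrA ler_pM2l.
Qed.

Lemma dyadic_scale r : 0 < r -> exists N j, [/\ (j < (N.*2).+1)%N,
  r <= 2 ^+ N / 2 ^+ j & 2 ^+ N / 2 ^+ j <= 2 * r].
Proof.
(* 2^N >= r makes j = 0 admissible, and 2^N >= 1/r forces every admissible j to be at most 2N. *)
move=> r0; set N := maxn (Num.truncn r).+1 (Num.truncn r^-1).+1.
have natlt (t : R) : t < 2 ^+ (Num.truncn t).+1.
  apply: (lt_le_trans (truncnS_gt t)); rewrite -natrX ler_nat.
  exact/ltnW/ltn_expl.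
have rN : r <= 2 ^+ N.
  by apply: (le_trans (ltW (natlt r))); rewrite ler_eXn2l// ?ltr1n// leq_maxl.
have rN' : r^-1 <= 2 ^+ N.
  by apply: (le_trans (ltW (natlt _))); rewrite ler_eXn2l// ?ltr1n// leq_maxr.
have ex : exists j, (r <= 2 ^+ N / 2 ^+ j) by exists 0; rewrite expr0 divr1.
have ub j : r <= 2 ^+ N / 2 ^+ j -> (j <= N.*2)%N.
  rewrite ler_pdivlMr ?exprn_gt0// => rj.
  rewrite -(@ler_eXn2l R 2)// ?ltr1n// -addnn exprD.
  rewrite -(ler_pM2l r0); apply: (le_trans rj).
  by rewrite mulrA ler_peMl ?exprn_ge0// -ler_pdivrMl// mulr1.
(* For the last j with r <= 2^(N-j), failure at j+1 gives 2^(N-j) < 2r. *)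
case: (ex_maxnP ex ub) => j rj jmax; exists N, j; split=> //.
  by rewrite ltnS; exact: ub.
have [rj1|rj1] := leP r (2 ^+ N / 2 ^+ j.+1).
  by have := jmax _ rj1; rewrite ltnn.
move: rj1; rewrite exprS invfM mulrCA mulrC ltr_pdivrMr// [r * 2]mulrC.
exact: ltW.
Qed.

End dyadic_comparison.

(** * The truncated dyadic maximal function and its integral against [mu] *)

Section dyadic_maximal.
Context {R : realType} {n : nat} (n_gt0 : (0 < n)%N).
Context (alpha : R) (alpha_ge0 : 0 <= alpha).
Context (nu : set 'rV[R]_n -> \bar R).
Hypothesis nu_ge0 : forall A, (0 <= nu A)%E.
Hypothesis nu_mono : forall A B, A `<=` B -> (nu A <= nu B)%E.
Hypothesis nu_finite : forall K, compact K -> (nu K < +oo)%E.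
Context (mu : {measure set 'rV[R]_n -> \bar R}).
Implicit Types (x y : 'rV[R]_n) (N i j m : nat).

Local Notation leb := (lebesgue_rV R n).
Local Notation K := ((8 * n%:R) ^+ n : R).

Definition side N j : R := 2 ^+ N / 2 ^+ j.

(** The g_j of the outline. [fine] loses nothing, 3Q being compact, and real values allow increments
    to be subtracted. *)
Definition dyadic_average N x j : R :=
  fine (nu (cube3 (side N j) (cube_index (side N j) x))) / side N j ^+ n.

Definition dyadic_frac N x j : R :=
  side N j `^ alpha * dyadic_average N x j.

Definition dyadic_maximal N x : R :=
  running_max (dyadic_frac N x) (N.*2).+1.

Definition dyadic_increment N x j : R :=
  running_max (dyadic_frac N x) j.+1 - running_max (dyadic_frac N x) j.

Lemma side_gt0 N j : 0 < side N j.
Proof. by rewrite divr_gt0 ?exprn_gt0. Qed.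

Lemma side_half N j : side N j = 2 * side N j.+1.
Proof. by rewrite /side exprS; field; rewrite expf_neq0. Qed.

Lemma side_shift N j : side N.+1 j.+1 = side N j.
Proof. by rewrite /side !exprS; field; rewrite expf_neq0. Qed.

Lemma side_le N i j : (i <= j)%N -> side N j <= side N i.
Proof.
by move=> ij; rewrite ler_wpM2l ?exprn_ge0// lef_pV2 ?posrE ?exprn_gt0//
  ler_eXn2l// ltr1n.
Qed.

Lemma dyadic_averageE N x j : (dyadic_average N x j)%:E =
  (nu (cube3 (side N j) (cube_index (side N j) x)) *
    ((side N j ^+ n)^-1)%:E)%E.
Proof.
rewrite /dyadic_average EFinM fineK// ge0_fin_numE//.
exact/nu_finite/compact_cube3.
Qed.

Lemma dyadic_average_ge0 N x j : 0 <= dyadic_average N x j.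
Proof. by rewrite divr_ge0 ?fine_ge0// exprn_ge0// ltW// side_gt0. Qed.

Lemma dyadic_average_le N x j :
  ((dyadic_average N x j)%:E <= K%:E * frac_maximal 0 nu x)%E.
Proof.
rewrite dyadic_averageE -[leLHS]mul1e.
rewrite (_ : 1%E = (side N j `^ 0)%:E); last by rewrite powRr0.
apply: average_le_frac_maximal => //; first exact: side_gt0.
exact/nu_mono/cube3_sub_eball/side_gt0.
Qed.

Lemma cube_index_side N i j x y : (i <= j)%N ->
  cube_index (side N j) x = cube_index (side N j) y ->
  cube_index (side N i) x = cube_index (side N i) y.
Proof.
elim: j => [|j IH]; first by rewrite leqn0 => /eqP->.
rewrite leq_eqVlt ltnS => /predU1P[->//|/IH{}IH] xy; apply: IH.
by rewrite side_half; apply: cube_index_double => //; exact: side_gt0.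
Qed.

(** Only scales up to m - 1 <= j enter, and their cubes are unions of cubes of scale j. *)
Lemma running_max_side N j m x y : (m <= j.+1)%N ->
  cube_index (side N j) x = cube_index (side N j) y ->
  running_max (dyadic_frac N x) m = running_max (dyadic_frac N y) m.
Proof.
elim: m => //= m IH mj xy; rewrite IH ?(ltnW mj)//; congr Num.max.
by rewrite /dyadic_frac /dyadic_average (cube_index_side _ _ j _ y).
Qed.

Lemma dyadic_increment_constant N j :
  cube_constant (side N j) (dyadic_increment N ^~ j).
Proof.
by move=> x y xy; rewrite /dyadic_increment !(running_max_side N j _ x y).
Qed.

Lemma dyadic_increment_ge0 N x j : 0 <= dyadic_increment N x j.
Proof. by rewrite subr_ge0 running_maxS. Qed.

Lemma dyadic_maximalE N x :
  dyadic_maximal N x = \sum_(j < (N.*2).+1) dyadic_increment N x j.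
Proof.
rewrite /dyadic_maximal; elim: _.+1 => [|m IH]; first by rewrite big_ord0.
by rewrite big_ord_recr -IH /dyadic_increment [RHS]addrC subrK.
Qed.

(** Passing from N to N + 1 shifts each scale index by one and adds one scale at either end. *)
Lemma dyadic_maximal_nd x :
  {homo dyadic_maximal ^~ x : N M / (N <= M)%N >-> N <= M}.
Proof.
apply/nondecreasing_seqP => N; apply: running_max_le => [|j jN].
  exact: running_max_ge0.
rewrite (_ : dyadic_frac N x j = dyadic_frac N.+1 x j.+1).
  by apply: ler_running_max; rewrite doubleS; lia.
by rewrite /dyadic_frac /dyadic_average side_shift.
Qed.

(** Each radius is within a factor 2 of some scale of some level N, and the limit over N dominates
    every level by monotonicity. *)
Lemma frac_maximal_le_dyadic x :
  (frac_maximal alpha nu x <=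
   ((2 * n%:R) ^+ n)%:E * limn (fun N => (dyadic_maximal N x)%:E))%E.
Proof.
apply: ge_ereal_sup => y [r]; rewrite /= in_itv/= andbT => r0 <-{y}.
have [N [j [jN rl lr]]] := dyadic_scale r r0.
apply: (le_trans (ball_average_le_cube3 n_gt0 _ _ _ _ _ _ _ rl lr _ _)) => //.
rewrite lee_pmul2l ?lte_fin ?exprn_gt0 ?mulr_gt0 ?ltr0n//.
rewrite -dyadic_averageE -EFinM.
have nd : nondecreasing_seq (fun N => (dyadic_maximal N x)%:E).
  by move=> a b ab; rewrite lee_fin; exact: dyadic_maximal_nd.
have /cvg_lim -> // := ereal_nondecreasing_cvgn nd.
apply: (@le_trans _ _ (dyadic_maximal N x)%:E).
  by rewrite lee_fin; exact: ler_running_max.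
by apply: ereal_sup_ubound; exists N.
Qed.

Lemma dyadic_increment_sum_le N x m :
  (\sum_(j < m) ((dyadic_increment N x j)%:E *
     (mu (cube (side N j) (cube_index (side N j) x)) *
      ((side N j ^+ n)^-1)%:E)) <=
   (K * K)%:E * (frac_maximal 0 nu x * frac_maximal alpha mu x))%E.
Proof.
have K0 : 0 <= K by rewrite exprn_ge0// mulr_ge0.
pose p j := (side N j `^ alpha)^-1.
have p0 j : 0 <= p j by rewrite invr_ge0 powR_ge0.
have M0 : (0 <= frac_maximal alpha mu x)%E by exact: frac_maximal_ge0.
(* One factor K comes from mu(Q)/l^n <= K l^-alpha M_alpha mu(x); the other will come from comparing
   g_j with M nu(x). *)
apply: (@le_trans _ _ (\sum_(j < m) ((dyadic_increment N x j * p j)%:E *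
    (K%:E * frac_maximal alpha mu x)))%E).
  apply: lee_sum => j _; rewrite [in leRHS]EFinM -muleA.
  apply: lee_wpmul2l; first by rewrite lee_fin dyadic_increment_ge0.
  rewrite [leRHS]muleC lee_pdivlMr ?powR_gt0 ?side_gt0// muleC.
  apply: average_le_frac_maximal => //; first exact: side_gt0.
  apply: le_measure; rewrite ?inE; [|exact: measurable_eball|].
    exact: (measurable_cube _ (side_gt0 N j)).
  exact/cube_sub_eball/side_gt0.
rewrite -ge0_sume_distrl; last first.
  by move=> j _; rewrite lee_fin mulr_ge0// dyadic_increment_ge0.
rewrite sumEFin EFinM -muleA (muleCA K%:E (frac_maximal 0 nu x)) muleA.
apply: lee_pmul => //.
- by rewrite lee_fin sumr_ge0// => j _; rewrite mulr_ge0// dyadic_increment_ge0.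
- by rewrite mule_ge0.
(* The largest g_j serves as a real intermediate bound, since [frac_maximal 0 nu x] may be
   infinite. *)
apply: (@le_trans _ _ (running_max (dyadic_average N x) m)%:E); last first.
  elim: m => [|m IH] /=.
    by rewrite mule_ge0// frac_maximal_ge0.
  by rewrite EFin_max ge_max IH dyadic_average_le.
rewrite lee_fin; apply: running_max_weighted => // [i j ij||j jm].
- rewrite lef_pV2 ?posrE ?powR_gt0 ?side_gt0// ge0_ler_powR//.
  + by rewrite nnegrE ltW// side_gt0.
  + by rewrite nnegrE ltW// side_gt0.
  + exact: side_le.
- exact: running_max_ge0.
rewrite mulKf ?gt_eqF ?powR_gt0 ?side_gt0//; exact: ler_running_max.
Qed.

Lemma measurable_dyadic_increment N j :
  measurable_fun setT (fun x => (dyadic_increment N x j)%:E).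
Proof.
apply: (measurable_cube_constant (side N j) (side_gt0 N j)) => x y xy.
by rewrite (dyadic_increment_constant _ _ _ _ xy).
Qed.

Lemma measurable_dyadic_maximal N :
  measurable_fun setT (fun x => (dyadic_maximal N x)%:E).
Proof.
under eq_fun do rewrite dyadic_maximalE -sumEFin.
by apply: emeasurable_sum => j; exact: measurable_dyadic_increment.
Qed.

Lemma integral_dyadic_maximal_le N :
  (\int[mu]_x (dyadic_maximal N x)%:E <=
   (K * K)%:E *
   \int[leb]_x (frac_maximal 0 nu x * frac_maximal alpha mu x))%E.
Proof.
have K0 : 0 < K * K by rewrite !mulr_gt0// exprn_gt0// mulr_gt0// ltr0n.
have d0 j x : (0 <= (dyadic_increment N x j)%:E)%E.
  by rewrite lee_fin dyadic_increment_ge0.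
under eq_integral do rewrite dyadic_maximalE -sumEFin.
rewrite ge0_integral_sum//; last first.
  by move=> j; exact: measurable_dyadic_increment.
pose w j x := ((dyadic_increment N x j)%:E *
  (mu (cube (side N j) (cube_index (side N j) x)) *
   ((side N j ^+ n)^-1)%:E))%E.
have w0 j x : (0 <= w j x)%E.
  by rewrite mule_ge0// mule_ge0// lee_fin invr_ge0 exprn_ge0// ltW// side_gt0.
have mw j : measurable_fun setT (w j).
  apply: (measurable_cube_constant (side N j) (side_gt0 N j)) => x y xy.
  by rewrite /w (dyadic_increment_constant _ _ _ _ xy) xy.
(* Each increment is integrated on the grid of its own scale, where it is constant. *)
rewrite (eq_bigr (fun j : 'I__ => \int[leb]_x w j x)%E); last first.
  move=> j _; apply: (integral_cube_constant (side N j) (side_gt0 N j)) => //.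
  by move=> x y xy; rewrite (dyadic_increment_constant _ _ _ _ xy).
rewrite -ge0_integral_sum//.
(* The constant moves to the left side, where the integrand is a measurable sum and can absorb it;
   the integrands are then compared pointwise. *)
rewrite muleC -lee_pdivrMr// muleC -ge0_integralZl_EFin//; last 2 first.
- by move=> x _; exact: sume_ge0.
- exact: emeasurable_sum.
apply: ge0_le_integralT => x.
  by rewrite mule_ge0 ?lee_fin ?invr_ge0 ?(ltW K0)// sume_ge0.
by rewrite muleC lee_pdivrMr// muleC dyadic_increment_sum_le.
Qed.

Lemma integral_frac_maximal_le :
  (\int[mu]_x frac_maximal alpha nu x <=
   ((2 * n%:R) ^+ n * (K * K))%:E *
   \int[leb]_x (frac_maximal 0 nu x * frac_maximal alpha mu x))%E.
Proof.
have c0 : 0 <= (2 * n%:R) ^+ n :> R by rewrite exprn_ge0// mulr_ge0.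
have T0 N x : (0 <= (dyadic_maximal N x)%:E)%E.
  by rewrite lee_fin running_max_ge0.
have Tnd x : nondecreasing_seq (fun N => (dyadic_maximal N x)%:E).
  by move=> a b ab; rewrite lee_fin; exact: dyadic_maximal_nd.
have Tlim0 x : (0 <= limn (fun N => (dyadic_maximal N x)%:E))%E.
  by apply: lime_ge; [exact: ereal_nondecreasing_is_cvgn|exact: nearW].
apply: (@le_trans _ _ (\int[mu]_x (((2 * n%:R) ^+ n)%:E *
    limn (fun N => (dyadic_maximal N x)%:E)))%E).
  apply: ge0_le_integralT => x; first exact: frac_maximal_ge0.
  exact: frac_maximal_le_dyadic.
rewrite ge0_integralZl_EFin//; last first.
  apply: (emeasurable_fun_cvg (fun N x => (dyadic_maximal N x)%:E)) => //.
    exact: measurable_dyadic_maximal.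
  by move=> x _; exact: ereal_nondecreasing_is_cvgn.
rewrite EFinM -muleA; apply: lee_wpmul2l; first by rewrite lee_fin.
(* The integral of the limit becomes the limit of integrals, all below a bound independent of N. *)
rewrite monotone_convergence//; last exact: measurable_dyadic_maximal.
apply: lime_le; last by apply: nearW => N; exact: integral_dyadic_maximal_le.
apply: ereal_nondecreasing_is_cvgn => a b ab.
by apply: ge0_le_integralT => // x; exact: Tnd.
Qed.

End dyadic_maximal.

(** * The inequality for nu = |f| dx, with an explicit constant *)

Theorem theorem2p9 (R : realType) (n : nat) (alpha : R)
    (alpha_ge0 : 0 <= alpha) (alpha_ltn : alpha < n%:R) :
  exists2 C : R, 0 < C &
    forall mu : {measure set 'rV[R]_n -> \bar R}, locally_finite mu ->
    forall f : 'rV[R]_n -> R, L1loc f ->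
      (L1norm mu (frac_maximal_fun alpha f) <=
       C%:E * weighted_L1norm (frac_maximal alpha mu) (HL_maximal_fun f))%E.
Proof.
have n0 : (0 < n)%N by rewrite -(ltr0n R); exact: le_lt_trans alpha_ltn.
have nR : 0 < n%:R :> R by rewrite ltr0n.
(* (2n)^n is the cost of replacing balls by dyadic cubes; the factors (8n)^n come from returning to
   balls, once for [nu] and once for [mu]. *)
exists ((2 * n%:R) ^+ n * ((8 * n%:R) ^+ n * (8 * n%:R) ^+ n)).
  by rewrite !(mulr_gt0, exprn_gt0).
move=> mu _ f [_ fK].
(* [nu] is a plain set function on arbitrary sets; the dyadic argument takes from it nonnegativity,
   monotonicity and finiteness on compact sets. *)
pose nu (A : set 'rV[R]_n) := (\int[lebesgue_rV R n]_(y in A) `|f y|%:E)%E.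
have nu0 A : (0 <= nu A)%E by apply: integral_ge0 => x _; rewrite lee_fin.
have nuS A B : A `<=` B -> (nu A <= nu B)%E.
  move=> AB; rewrite /nu integral_mkcond [leRHS]integral_mkcond.
  apply: ge0_le_integralT => x.
    by apply: erestrict_ge0 => y _; rewrite lee_fin.
  rewrite !patchE; case: ifPn => [xA|_].
    by rewrite (mem_set (AB _ (set_mem xA))).
  by case: ifP => // _; rewrite lee_fin.
rewrite /L1norm /weighted_L1norm.
rewrite (eq_integral (frac_maximal alpha nu)); last first.
  by move=> x _; rewrite gee0_abs// frac_maximal_ge0.
rewrite [X in (_ * X)%E](eq_integral (fun x =>
  frac_maximal 0 nu x * frac_maximal alpha mu x)%E); last first.
  by move=> x _; rewrite gee0_abs// frac_maximal_ge0.
exact: integral_frac_maximal_le.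
Qed.
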